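(* Suppose $I\subset\mathbb R$ is a closed interval. Let $f,g\in\mathrm{Diffeo}^+(I)$. Then there exists $h\in\mathrm{Diffeo}^+(I)$ such that $f=h^{-1}\circ g\circ h$ if and only if there exists $h_1\in\mathrm{Diffeo}^+(I)$ such that the following three conditions hold: (1) $h_1(\mathrm{fix}(f))=\mathrm{fix}(g)$; (2) letting $f_1=h_1\circ f\circ h_1^{-1}$ and $E=\mathrm{fix}(g)$, we have $$\mathrm{sign}(f_1(x)-x)=\mathrm{sign}(g(x)-x),\qquad\forall x\in I\setminus E;$$ (3) there exists $h_2\in\mathrm{Diffeo}^+_{\mathrm{bdy}\,E}(I)$ such that $f_1=h_2^{-1}\circ g\circ h_2$.
   Context: $\mathrm{Diffeo}^+(I)$ is the group of orientation-preserving infinitely differentiable diffeomorphisms of $I$. $\mathrm{fix}(f)$ is the set of fixed points of $f$ in $I$. $\mathrm{bdy}\,E$ is the boundary of $E$. For a closed set $A\subset I$, $\mathrm{Diffeo}^+_A(I)=\{f\in\mathrm{Diffeo}^+(I): f(x)=x\ \forall x\in A\}$. *)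

(* Defs.v *)
From HB Require Import structures.
From mathcomp Require Import all_boot all_order all_algebra.
From mathcomp Require Import all_classical all_reals all_analysis.

Set Implicit Arguments.
Unset Strict Implicit.
Unset Printing Implicit Defensive.

Import Order.TTheory GRing.Theory Num.Theory.
Import numFieldNormedType.Exports.

Local Open Scope classical_set_scope.
Local Open Scope ring_scope.

(* Self-maps of a closed interval I are represented by functions R -> R of
   which only the values on I matter; equality of such maps is {in I, _ =1 _}. *)

Section interval_diffeomorphisms.
Context {R : realType}.
Implicit Types (I A E : set R) (f g : R -> R) (x l : R).

(* The derivative at x of f restricted to I, i.e., one-sided at an endpoint. *)
Definition is_derive_on I f x l : Prop :=
  (f y - f x) / (y - x) @[y --> within I x^'] --> l.

(* C^oo on I: D n is the n-th derivative of f on I. *)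
Definition smooth_on I f : Prop :=
  exists D : nat -> R -> R,
    {in I, D 0%N =1 f} /\
    (forall n x, I x -> is_derive_on I (D n) x (D n.+1 x)).

Definition Diffeop I : set (R -> R) :=
  [set f | [/\ set_bij I I f,
               smooth_on I f,
               smooth_on I (pinv I f) &
               {in I &, {homo f : x y / x < y}}]].

Definition fix_on I f : set R := [set x | I x /\ f x = x].

(* The boundary is taken in R and not relatively to I. The two differ at most
   by endpoints of I, which every element of Diffeop I fixes. *)
Definition bdy E : set R := closure E `\` E°.

Definition Diffeop_fixing I A : set (R -> R) :=
  [set f | Diffeop I f /\ (forall x, A x -> f x = x)].

End interval_diffeomorphisms.

(* Main.v *)
Require Import Defs.
From HB Require Import structures.
From mathcomp Require Import all_boot all_order all_algebra.
From mathcomp Require Import all_classical all_reals all_analysis.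
From mathcomp Require Import ring.

(** The equivalence is a formal consequence of the fact that the
    orientation-preserving smooth diffeomorphisms of I are closed under
    composition.  If h conjugates f to g, then h itself serves as the first
    conjugacy: it turns f into exactly g, so that conditions (1) and (2) are
    immediate and the second conjugacy is the identity.  Conversely, if h1
    turns f into f1 and h2 conjugates f1 to g, then h2 \o h1 conjugates f to g.
    The analytic content is therefore that compositions of maps smooth on I are
    smooth on I ([smooth_on_comp]).

    Since [smooth_on] asks for a whole sequence of successive derivatives, the
    proof exhibits one.  Repeated use of the chain, product and sum rules on
    u \o v only ever produces polynomials in the functions u^(k) \o v and
    v^(k).  These polynomials are represented by formal terms ([jet]) with a
    formal derivation ([jet_deriv]) that their evaluation turns into the actual
    derivative ([is_derive_on_jet]); iterating the derivation on the term for
    u \o v gives the required sequence, so no closed formula for the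
    higher derivatives of a composite is needed.  The rules of calculus at
    possibly one-sided points all come from the Caratheodory form of
    differentiability ([is_derive_onP]). *)

Import Order.TTheory GRing.Theory Num.Theory.
Import numFieldNormedType.Exports.

Local Open Scope classical_set_scope.
Local Open Scope ring_scope.

(** * Differentiation relative to a set *)

Section derive_on.
Context {R : realType}.
Implicit Types (I : set R) (f g u v : R -> R) (x l m : R).

(** Caratheodory's criterion: unlike the difference quotient, the factor [phi]
    is defined at [x] as well, so a chain rule obtained by substituting into it
    does not have to exclude that the inner function returns to its value at
    [x]. *)
Lemma is_derive_onP I f x l :
  is_derive_on I f x l <->
  exists2 phi : R -> R, forall y, f y - f x = phi y * (y - x) &
    phi y @[y --> within I (nbhs x)] --> l.
Proof.
split=> [dfx|[phi phiE phil]].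
  exists (fun y => if y == x then l else (f y - f x) / (y - x)) => [y|].
    have [->|yx] := eqVneq y x; first by rewrite !subrr mulr0.
    by rewrite divfK// subr_eq0.
  move=> U Ul.
  have nearU : \forall y \near x, y != x -> I y -> U ((f y - f x) / (y - x)).
    exact: dfx Ul.
  apply: filterS nearU => y /= yU Iy.
  have [_|yx] := eqVneq y x; first exact: nbhs_singleton.
  exact: yU.
move=> U Ul.
have nearU : \forall y \near x, I y -> U (phi y) by exact: phil Ul.
apply: filterS nearU => y /= yU yx Iy.
by rewrite phiE mulfK ?subr_eq0//; exact: yU.
Qed.

Lemma is_derive_on_cvg I f x l :
  is_derive_on I f x l -> f y @[y --> within I (nbhs x)] --> f x.
Proof.
move=> /is_derive_onP[phi phiE phil].
have fE : (fun y => phi y * (y - x) + f x) = f.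
  by apply/funext => y; rewrite -phiE subrK.
suff : phi y * (y - x) + f x @[y --> within I (nbhs x)] --> l * (x - x) + f x.
  by rewrite fE subrr mulr0 add0r.
apply: cvgD; last exact: cvg_cst.
by apply: cvgM => //; apply: cvgB; [exact: cvg_within|exact: cvg_cst].
Qed.

Lemma is_derive_onD I f g x l m :
  is_derive_on I f x l -> is_derive_on I g x m ->
  is_derive_on I (fun y => f y + g y) x (l + m).
Proof.
move=> /is_derive_onP[phi phiE phil] /is_derive_onP[psi psiE psim].
apply/is_derive_onP; exists (fun y => phi y + psi y); last exact: cvgD.
by move=> y; rewrite mulrDl -phiE -psiE; ring.
Qed.

Lemma is_derive_onM I f g x l m :
  is_derive_on I f x l -> is_derive_on I g x m ->
  is_derive_on I (fun y => f y * g y) x (l * g x + f x * m).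
Proof.
move=> df dg; have gx := is_derive_on_cvg _ _ _ _ dg.
move: df dg => /is_derive_onP[phi phiE phil] /is_derive_onP[psi psiE psim].
apply/is_derive_onP; exists (fun y => phi y * g y + f x * psi y).
  move=> y; rewrite mulrDl (mulrAC (phi y)) -phiE -mulrA -psiE; ring.
by apply: cvgD; apply: cvgM => //; exact: cvg_cst.
Qed.

Lemma is_derive_on_comp I u v x l m : I x -> (forall y, I y -> I (v y)) ->
  is_derive_on I u (v x) l -> is_derive_on I v x m ->
  is_derive_on I (u \o v) x (l * m).
Proof.
move=> Ix Iv du dv; have vx := is_derive_on_cvg _ _ _ _ dv.
move: du dv => /is_derive_onP[phi phiE phil] /is_derive_onP[psi psiE psim].
apply/is_derive_onP; exists (fun y => phi (v y) * psi y).
  by move=> y; rewrite /= phiE psiE mulrA.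
apply: cvgM => //.
have vxI : v y @[y --> within I (nbhs x)] --> within I (nbhs (v x)).
  move=> U UI.
  have nearU : \forall y \near x, I y -> I (v y) -> U (v y) by exact: vx UI.
  by apply: filterS nearU => y /= IU Iy; apply: IU => //; exact: Iv.
exact: (cvg_comp _ _ vxI phil).
Qed.

Lemma is_derive_on_id I x : is_derive_on I id x 1.
Proof.
apply/is_derive_onP; exists (fun=> 1); last exact: cvg_cst.
by move=> y; rewrite mul1r.
Qed.

Lemma is_derive_on_cst I c x : is_derive_on I (fun=> c) x 0.
Proof.
apply/is_derive_onP; exists (fun=> 0); last exact: cvg_cst.
by move=> y; rewrite mul0r subrr.
Qed.

End derive_on.

(** * Smoothness of composite maps *)

(** The atoms [JetOuter k] and [JetInner k] stand for u^(k) \o v and v^(k). *)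
Inductive jet :=
| JetOuter of nat
| JetInner of nat
| JetAdd of jet & jet
| JetMul of jet & jet.

Fixpoint jet_deriv (e : jet) : jet :=
  match e with
  | JetOuter k => JetMul (JetOuter k.+1) (JetInner 1)
  | JetInner k => JetInner k.+1
  | JetAdd a b => JetAdd (jet_deriv a) (jet_deriv b)
  | JetMul a b => JetAdd (JetMul (jet_deriv a) b) (JetMul a (jet_deriv b))
  end.

Fixpoint jet_eval {R : realType} (Du Dv : nat -> R -> R) (e : jet) : R -> R :=
  match e with
  | JetOuter k => Du k \o Dv 0
  | JetInner k => Dv k
  | JetAdd a b => fun x => jet_eval Du Dv a x + jet_eval Du Dv b x
  | JetMul a b => fun x => jet_eval Du Dv a x * jet_eval Du Dv b x
  end.

Section smooth_on.
Context {R : realType}.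
Implicit Types (I : set R) (u v : R -> R).

(** [Du] and [Dv] are arbitrary sequences of successive derivatives on [I]:
    derivatives need not be unique there, as [I] may have isolated points. *)
Lemma is_derive_on_jet I (Du Dv : nat -> R -> R) (e : jet) (x : R) :
  (forall n y, I y -> is_derive_on I (Du n) y (Du n.+1 y)) ->
  (forall n y, I y -> is_derive_on I (Dv n) y (Dv n.+1 y)) ->
  (forall y, I y -> I (Dv 0 y)) -> I x ->
  is_derive_on I (jet_eval Du Dv e) x (jet_eval Du Dv (jet_deriv e) x).
Proof.
move=> dDu dDv IDv Ix; elim: e => [k|k|a IHa b IHb|a IHa b IHb] /=.
- by apply: is_derive_on_comp => //; [apply: dDu; exact: IDv|exact: dDv].
- exact: dDv.
- exact: is_derive_onD.
- exact: is_derive_onM.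
Qed.

Lemma eq_smooth_on I u v : {in I, u =1 v} -> smooth_on I u -> smooth_on I v.
Proof.
by move=> uv [D [D0 dD]]; exists D; split=> // x Ix; rewrite D0// uv.
Qed.

Lemma smooth_on_comp I u v : (forall x, I x -> I (v x)) ->
  smooth_on I u -> smooth_on I v -> smooth_on I (u \o v).
Proof.
move=> Iv [Du [Du0 dDu]] [Dv [Dv0 dDv]].
have IDv y : I y -> I (Dv 0 y) by move=> Iy; rewrite Dv0 ?inE//; exact: Iv.
exists (fun n => jet_eval Du Dv (iter n jet_deriv (JetOuter 0))).
split=> [x|n x Ix]; last exact: is_derive_on_jet.
by rewrite inE => Ix /=; rewrite Dv0 ?inE// Du0// inE; exact: Iv.
Qed.

Lemma smooth_on_id I : smooth_on I id.
Proof.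
exists (fun n => match n with 0 => id | 1 => fun=> 1 | _ => fun=> 0 end).
split=> // -[|[|n]] x Ix; [exact: is_derive_on_id| |];
  exact: is_derive_on_cst.
Qed.

End smooth_on.

(** * Composition of diffeomorphisms *)

Section pinv.
Context {T : pointedType} {I : set T}.
Implicit Types (h : T -> T) (x : T).

Lemma set_bij_pinv_fun h x : set_bij I I h -> I x -> I (pinv I h x).
Proof. by move=> [_ _ hS] Ix; apply: (surjpinv_image_sub hS); exists x. Qed.

Lemma set_bij_pinvKV h x : set_bij I I h -> I x -> pinv I h (h x) = x.
Proof. by move=> [_ hV _] Ix; apply: (pinvKV _ hV); rewrite inE. Qed.

Lemma set_bij_pinvK h x : set_bij I I h -> I x -> h (pinv I h x) = x.
Proof. by move=> [_ _ hS] Ix; apply: (surjpK _ hS); rewrite inE. Qed.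

Lemma pinv_id x : I x -> pinv I id x = x.
Proof.
by apply: (set_bij_pinvKV id); split=> // y Iy; exists y.
Qed.

(** The two sides are arbitrary extensions of the same inverse bijection, so
    they may differ outside [I]. *)
Lemma pinv_comp h1 h2 : set_bij I I h1 -> set_bij I I h2 ->
  {in I, pinv I (h2 \o h1) =1 pinv I h1 \o pinv I h2}.
Proof.
move=> h1I h2I x; rewrite inE => Ix.
rewrite -{1}(set_bij_pinvK _ _ h2I Ix).
rewrite -{1}(set_bij_pinvK _ _ h1I (set_bij_pinv_fun _ _ h2I Ix)).
rewrite (set_bij_pinvKV (h2 \o h1))//; first exact: set_bij_comp h1I h2I.
exact/set_bij_pinv_fun/set_bij_pinv_fun.
Qed.

End pinv.

Section Diffeop.
Context {R : realType} {I : set R}.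
Implicit Types (h : R -> R).

Lemma Diffeop_id : Diffeop I id.
Proof.
split; [by split=> // x Ix; exists x|exact: smooth_on_id| |by []].
by apply: eq_smooth_on (smooth_on_id I) => x; rewrite inE => /pinv_id ->.
Qed.

Lemma Diffeop_comp h1 h2 :
  Diffeop I h1 -> Diffeop I h2 -> Diffeop I (h2 \o h1).
Proof.
move=> [h1I h1S h1VS h1lt] [h2I h2S h2VS h2lt].
have Ih1 : forall x, I x -> I (h1 x) by case: h1I.
split; first exact: set_bij_comp h1I h2I.
- exact: smooth_on_comp.
- apply: (eq_smooth_on _ (pinv I h1 \o pinv I h2)).
    by move=> x xI; rewrite pinv_comp.
  by apply: smooth_on_comp => // x; exact: set_bij_pinv_fun.
- move=> x y; rewrite !inE => Ix Iy xy.
  by apply: h2lt; rewrite ?inE; [exact: Ih1|exact: Ih1|apply: h1lt; rewrite ?inE].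
Qed.

End Diffeop.

(** * Conjugacy *)

Theorem proposition2p13 (R : realType) (I : set R)
    (I_closed : closed I) (I_itv : is_interval I)
    (f g : R -> R) (hf : Diffeop I f) (hg : Diffeop I g) :
  (exists h : R -> R, Diffeop I h /\ {in I, f =1 pinv I h \o g \o h})
  <->
  (exists h1 : R -> R, Diffeop I h1 /\
     let f1 := h1 \o f \o pinv I h1 in
     let E := fix_on I g in
     [/\ h1 @` fix_on I f = E,
         (forall x, (I `\` E) x -> Num.sg (f1 x - x) = Num.sg (g x - x)) &
         (exists h2 : R -> R, Diffeop_fixing I (bdy E) h2 /\
            {in I, f1 =1 pinv I h2 \o g \o h2})]).
Proof.
have If x : I x -> I (f x) by case: hf => -[fI _ _] _ _ _; exact: fI.
have Ig x : I x -> I (g x) by case: hg => -[gI _ _] _ _ _; exact: gI.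
split=> [[h [hD fE]]|[h1 [h1D [_ _ [h2 [[h2D _] f1E]]]]]].
  have [hI _ _ _] := hD.
  have Ih x : I x -> I (h x) by case: hI => hI _ _; exact: hI.
  have hfE x : I x -> h (f x) = g (h x).
    move=> Ix; rewrite fE ?inE//=.
    by rewrite set_bij_pinvK//; exact/Ig/Ih.
  have f1E x : I x -> h (f (pinv I h x)) = g x.
    move=> Ix; rewrite hfE ?set_bij_pinvK//; exact: set_bij_pinv_fun.
  exists h; split=> //=; split.
  - apply/seteqP; split=> [_ [x [Ix fx] <-]|y [Iy gy]].
      by split; [exact: Ih|rewrite -hfE// fx].
    exists (pinv I h y); last exact: set_bij_pinvK.
    split; first exact: set_bij_pinv_fun.
    rewrite -[in RHS]gy -f1E// set_bij_pinvKV//.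
    exact/If/set_bij_pinv_fun.
  - by move=> x [Ix _]; rewrite f1E.
  - exists id; split; first by split; [exact: Diffeop_id|].
    by move=> x; rewrite inE => Ix /=; rewrite f1E// pinv_id//; exact: Ig.
exists (h2 \o h1); split; first exact: Diffeop_comp.
have [h1I _ _ _] := h1D; have [h2I _ _ _] := h2D.
have Ih1 x : I x -> I (h1 x) by case: h1I => h1I' _ _; exact: h1I'.
have Ih2 x : I x -> I (h2 x) by case: h2I => h2I' _ _; exact: h2I'.
move=> x; rewrite inE => Ix.
rewrite /= pinv_comp ?inE//; last exact/Ig/Ih2/Ih1.
have /= := f1E (h1 x); rewrite inE => <-; last exact: Ih1.
by rewrite set_bij_pinvKV// set_bij_pinvKV//; exact: If.
Qed.
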